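(* Let $\mathcal{X}$ be a (real or complex) Banach space with $\dim \mathcal{X}\geq 2$, let $\mathcal{N}$ be a nest on $\mathcal{X}$ such that each $N\in\mathcal{N}$ with $N_{-}=N$ is complemented in $\mathcal{X}$, and let $\psi: Alg\mathcal{N}\rightarrow Alg\mathcal{N}$ be a linear map. (i) $\psi$ is a right ideal preserving map if and only if $\psi$ is a right centralizer. (ii) $\psi$ is a left ideal preserving map if and only if $\psi$ is a left centralizer.
   Context: A nest $\mathcal{N}$ on a Banach space $\mathcal{X}$ is a chain (under inclusion) of norm-closed subspaces of $\mathcal{X}$ containing $\{0\}$ and $\mathcal{X}$ such that for every family $\{N_i\}$ of elements of $\mathcal{N}$, both $\bigcap N_i$ and $\bigvee N_i$ (the closed linear span of the $N_i$) belong to $\mathcal{N}$. The nest algebra $Alg\mathcal{N}$ is the algebra of all bounded linear operators on $\mathcal{X}$ that leave every member of $\mathcal{N}$ invariant. For $N\in\mathcal{N}$, $N_{-}:=\bigvee\{M\in\mathcal{N} : M\subsetneq N\}$. For an algebra $\mathcal{A}$, a linear map $\rho:\mathcal{A}\to\mathcal{A}$ is a right (respectively left) centralizer if $\rho(ab)=a\rho(b)$ (respectively $\rho(ab)=\rho(a)b$) for all $a,b\in\mathcal{A}$. A linear map $\psi:\mathcal{A}\to\mathcal{A}$ is right (left) ideal preserving if $\psi(\mathcal{J})\subseteq\mathcal{J}$ for every right (left) ideal $\mathcal{J}$ of $\mathcal{A}$ (ideals are not assumed closed). Linear maps are linear over the scalar field of $\mathcal{X}$ and are not assumed continuous. *)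

(* Defs.v *)
From HB Require Import structures.
From mathcomp Require Import all_boot all_order all_algebra.
From mathcomp Require Import complex.
From mathcomp Require Import all_classical all_reals all_analysis.

Set Implicit Arguments.
Unset Strict Implicit.
Unset Printing Implicit Defensive.

Import Order.TTheory GRing.Theory Num.Theory.
Import numFieldNormedType.Exports.

Local Open Scope classical_set_scope.
Local Open Scope ring_scope.

Variant scalar_kind := RealScalars | ComplexScalars.

Definition scalars (R : realType) (k : scalar_kind) : numFieldType :=
  match k with
  | RealScalars => R
  | ComplexScalars => R[i]
  end.

Definition is_subspace (K : pzRingType) (V : lmodType K) (A : set V) : Prop :=
  submod_closed [in A].

Section BanachSpace.
Context {K : numFieldType} {X : completeNormedModType K}.
Implicit Types (A M N : set X) (F : set (set X)).

Definition dim_ge (n : nat) : Prop :=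
  exists u : 'I_n -> X, forall c : 'I_n -> K,
    \sum_i c i *: u i = 0 -> forall i, c i = 0.

Definition closed_subspace N : Prop := is_subspace N /\ closed N.

Definition linear_span A : set X := smallest (@is_subspace K X) A.

(* Closed linear span of a family; it is {0} when F is empty, so the join of
   the empty family in [is_nest] adds nothing to {0} being in the nest. *)
Definition closed_join F : set X :=
  closure (linear_span (\bigcup_(M in F) M)).

Definition complemented N : Prop :=
  exists M, [/\ closed_subspace M, N `&` M = [set 0] &
    forall x, exists y z, [/\ N y, M z & x = y + z]].

(* Over R[i], 0 <= C forces C to be a nonnegative real. *)
Definition bounded_linear (T : X -> X) : Prop :=
  linear T /\ exists2 C : K, 0 <= C & forall x, `|T x| <= C * `|x|.

Definition is_nest F : Prop :=
  [/\ forall N, F N -> closed_subspace N,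
      forall M N, F M -> F N -> M `<=` N \/ N `<=` M,
      F [set 0] /\ F setT,
      forall G, G `<=` F -> F (\bigcap_(M in G) M) &
      forall G, G `<=` F -> F (closed_join G)].

Definition nest_pred F N : set X := closed_join [set M | F M /\ M `<` N].

Definition Alg F : set (X -> X) :=
  [set T | bounded_linear T /\ forall N, F N -> forall x, N x -> N (T x)].

End BanachSpace.

Arguments dim_ge {K} X n.

Record nest (K : numFieldType) (X : completeNormedModType K) := Nest {
  nest_set :> set (set X);
  nestP : is_nest nest_set }.

Section NestAlgebra.
Context {K : numFieldType} {X : completeNormedModType K}.
Variable N : nest X.

Definition alg_pred : {pred X -> X} := [in Alg N].

Record nest_alg := NestAlg {
  nest_op :> X -> X;
  nest_opP : nest_op \in alg_pred }.

HB.instance Definition _ := [isSub for nest_op].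
HB.instance Definition _ := [Choice of nest_alg by <:].

Lemma bounded_linear_add (S T : X -> X) (a : K) :
  bounded_linear S -> bounded_linear T -> bounded_linear (a *: S + T).
Proof.
move=> [lS [C C0 bS]] [lT [D D0 bT]]; split.
  move=> b x y; have E z : (a *: S + T) z = a *: S z + T z by [].
  rewrite !E lS lT !scalerDr !scalerA (mulrC b a) -!addrA; congr (_ + _).
  by rewrite addrCA.
exists (`|a| * C + D) => [|x]; first by rewrite addr_ge0 ?mulr_ge0.
rewrite (le_trans (ler_normD _ _))// mulrDl lerD// normrZ -mulrA.
by rewrite ler_wpM2l.
Qed.

Lemma Alg_submod_closed : submod_closed alg_pred.
Proof.
have [Nsub _ _ _ _] := nestP N.
split.
  rewrite inE; split.
    split; first by move=> a x y; rewrite /= scaler0 addr0.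
    by exists 0 => // x; rewrite normr0 mul0r.
  by move=> M /Nsub[[+ _] _] x _; rewrite inE.
move=> a S T; rewrite !inE => -[bS iS] [bT iT]; split.
  exact: bounded_linear_add.
move=> M NM x Mx; have [[_ Mlin] _] := Nsub _ NM.
have := Mlin a (S x) (T x); rewrite !inE; apply.
- exact: iS NM _ Mx.
- exact: iT NM _ Mx.
Qed.

HB.instance Definition _ :=
  GRing.isSubmodClosed.Build K (X -> X) alg_pred Alg_submod_closed.

HB.instance Definition _ := [SubChoice_isSubLmodule of nest_alg by <:].

Lemma Alg_id : idfun \in alg_pred.
Proof.
rewrite inE; split => //; split; first by [].
by exists 1 => // x; rewrite mul1r.
Qed.

Lemma Alg_comp (S T : X -> X) : 
  S \in alg_pred -> T \in alg_pred -> S \o T \in alg_pred.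
Proof.
rewrite !inE => -[[lS [C C0 bS]] iS] [[lT [D D0 bT]] iT]; split.
  split; first by move=> a x y; rewrite /= lT lS.
  exists (C * D) => [|x]; first exact: mulr_ge0.
  by rewrite /= (le_trans (bS _))// -mulrA ler_wpM2l.
by move=> M NM x Mx; apply: (iS _ NM); apply: iT NM _ Mx.
Qed.

Definition nest_one : nest_alg := NestAlg Alg_id.

Definition nest_mul (S T : nest_alg) : nest_alg :=
  NestAlg (Alg_comp (nest_opP S) (nest_opP T)).

Lemma nest_mulA : associative nest_mul.
Proof. by move=> S T U; apply: val_inj. Qed.

Lemma nest_mul1r : left_id nest_one nest_mul.
Proof. by move=> S; apply: val_inj. Qed.

Lemma nest_mulr1 : right_id nest_one nest_mul.
Proof. by move=> S; apply: val_inj. Qed.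

Lemma nest_mulDl : left_distributive nest_mul +%R.
Proof. by move=> S T U; apply: val_inj. Qed.

Lemma nest_mulDr : right_distributive nest_mul +%R.
Proof.
move=> S T U; apply: val_inj; apply/funext => x /=.
have /set_mem[[lS _] _] := nest_opP S.
by have := lS 1 (T x) (U x); rewrite !scale1r.
Qed.

(* Only a possibly zero ring: 1 = 0 when X = {0}, hence no [algType] here. *)
HB.instance Definition _ := GRing.Zmodule_isPzRing.Build nest_alg
  nest_mulA nest_mul1r nest_mulr1 nest_mulDl nest_mulDr.

Definition right_centralizer (rho : nest_alg -> nest_alg) : Prop :=
  forall a b, rho (a * b) = a * rho b.

Definition left_centralizer (rho : nest_alg -> nest_alg) : Prop :=
  forall a b, rho (a * b) = rho a * b.

Definition right_ideal (J : set nest_alg) : Prop :=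
  is_subspace J /\ forall j a, J j -> J (j * a).

Definition left_ideal (J : set nest_alg) : Prop :=
  is_subspace J /\ forall a j, J j -> J (a * j).

Definition right_ideal_preserving (psi : nest_alg -> nest_alg) : Prop :=
  forall J, right_ideal J -> psi @` J `<=` J.

Definition left_ideal_preserving (psi : nest_alg -> nest_alg) : Prop :=
  forall J, left_ideal J -> psi @` J `<=` J.

End NestAlgebra.

(* Main.v *)
Require Import Defs.
From HB Require Import structures.
From mathcomp Require Import all_boot all_order all_algebra.
From mathcomp Require Import complex.
From mathcomp Require Import all_classical all_reals all_analysis.
From mathcomp Require Import ring lra.
Import Order.TTheory GRing.Theory Num.Theory.
Import numFieldNormedType.Exports.
Local Open Scope classical_set_scope.
Local Open Scope ring_scope.

(** Write [A] for the nest algebra, which is unital.  A centralizer preserves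
    ideals because [psi j = j * psi 1] (or [psi 1 * j]).  For the converse, let
    [psi] preserve right ideals and let [e] be an idempotent of [A].  As
    [psi] maps [e A] into itself and [(1 - e) A] into itself, splitting
    [a = e a + (1 - e) a] gives [psi (e a) = e psi a]
    ([local_right_centralizer_idempotent]).  Hence [psi (r a) = r psi a]
    whenever [r] is a linear combination of idempotents.

    Suppose that both [r] and [r a] are such combinations.  Computing
    [psi (r a)] as [r psi a] and as [(r a) psi 1] shows that [r] kills
    [psi a - a psi 1].  So it is enough to have sufficiently many rank-one
    operators, [y |-> f y *: x], among these combinations; note that [r a] is
    again of rank one, with the same [x] and with [f \o a] instead of [f].  Such
    an operator lies in [A] as soon as some [M] in the nest contains [x] and [f]
    vanishes on [M_-] ([rank_one_exists]).  It is a multiple of an idempotent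
    when [f x != 0]; otherwise one tries to write it as a difference:
    - if [M_- <> M], one moves [f] or [x] a little, using a functional [g]
      that vanishes on [M_-] with [g x != 0], or a vector [y] of [M] with
      [f y != 0];
    - if [M_- = M], that is impossible, and the hypothesis that [M] is
      complemented enters: with [P] a bounded projection onto [M], both [P] and
      [P + r] are idempotents of [A].

    These rank-one operators suffice because a nonzero vector always avoids
    [M_-] for some nonzero [M] of the nest ([nest_pred_separates]), so that a
    functional separates it from [M_-].  Left ideals are handled in the same way
    in the converse ring; there one concludes that [psi a - psi 1 a] vanishes on
    every [M] with [M_- <> X], and these span a dense subspace
    ([nest_join_full]).

    Two classical theorems supply the functionals and the projections: the
    Hahn-Banach theorem ([hahn_banach], [separation]) and the closed graph
    theorem ([closed_graph], [complemented_projection]).  Both are proved over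
    the real numbers; complex Banach spaces are reduced to real ones by
    restriction of scalars ([realified]). *)

Set Implicit Arguments.
Unset Strict Implicit.
Unset Printing Implicit Defensive.

(** * Complex Banach spaces as real Banach spaces *)

Section Realification.
Context {R : realType}.
Local Open Scope complex_scope.

Lemma Re_ge0K (c : R[i]) : 0 <= c -> (complex.Re c)%:C = c.
Proof. by move=> c0; rewrite RRe_real// ger0_real. Qed.

(** An alias of [X] that carries the real structures below.  Its topology and
    its uniform structure are copied from [X], so closed sets, limits and
    completeness are literally the same in both spaces. *)
Definition realified (X : completeNormedModType R[i]) : Type := X.

Variable X : completeNormedModType R[i].
Local Notation Y := (realified X).

HB.instance Definition _ := Complete.copy Y X.
HB.instance Definition _ := GRing.Zmodule.copy Y X.

Definition real_norm (x : Y) : R := complex.Re `|x : X|.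

Lemma real_normE (x : Y) : (real_norm x)%:C = `|x : X|.
Proof. exact: Re_ge0K. Qed.

Definition real_scale (a : R) (x : Y) : Y := a%:C *: (x : X).

Fact real_scaleA a b (x : Y) : real_scale a (real_scale b x) = real_scale (a * b) x.
Proof. by rewrite /real_scale scalerA rmorphM. Qed.
Fact real_scale1 : left_id 1 real_scale.
Proof. by move=> x; rewrite /real_scale scale1r. Qed.
Fact real_scaleDr : right_distributive real_scale +%R.
Proof. by move=> a x y; rewrite /real_scale scalerDr. Qed.
Fact real_scaleDl x : {morph real_scale^~ x : a b / a + b}.
Proof. by move=> a b; rewrite /real_scale rmorphD scalerDl. Qed.

HB.instance Definition _ := GRing.Zmodule_isLmodule.Build R Y
  real_scaleA real_scale1 real_scaleDr real_scaleDl.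

Fact real_normD (x y : Y) : real_norm (x + y) <= real_norm x + real_norm y.
Proof. by rewrite -lecR rmorphD /= !real_normE ler_normD. Qed.
Fact real_norm0_eq0 (x : Y) : real_norm x = 0 -> x = 0.
Proof.
by move=> x0; apply/eqP; rewrite -(normr_eq0 (x : X)) -real_normE x0.
Qed.
Fact real_normMn (x : Y) n : real_norm (x *+ n) = real_norm x *+ n.
Proof.
by apply: complexI; rewrite rmorphMn /= !real_normE normrMn.
Qed.
Fact real_normN (x : Y) : real_norm (- x) = real_norm x.
Proof. by rewrite /real_norm normrN. Qed.

HB.instance Definition _ := Num.Zmodule_isNormed.Build R Y
  real_normD real_norm0_eq0 real_normMn real_normN.

Let B := ball_ (fun x : Y => `|x|).
Lemma real_ballE (x : Y) (e : R) : B x e = ball (x : X) e%:C.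
Proof.
by rewrite -ball_normE; apply/funext => y; rewrite /B /= -ltcR real_normE.
Qed.

Fact real_ball_center (x : Y) e : 0 < e -> B x e x.
Proof. by move=> e0; rewrite real_ballE; apply: ballxx; rewrite ltcR. Qed.
Fact real_ball_sym x y e : B x e y -> B y e x.
Proof. by rewrite !real_ballE; exact: ball_sym. Qed.
Fact real_ball_triangle x y z e1 e2 : B x e1 y -> B y e2 z -> B x (e1 + e2) z.
Proof. rewrite !real_ballE rmorphD; exact: ball_triangle. Qed.
Fact real_entourageE : entourage = entourage_ B.
Proof.
rewrite (_ : entourage = @entourage X)// -entourage_ballE.
apply/seteqP; split => A [e /= e0 BA].
  exists (complex.Re e) => /=.
    by rewrite -ltcR Re_ge0K// ltW.
  by move=> xy /=; rewrite real_ballE Re_ge0K ?(ltW e0)//; exact: BA.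
exists e%:C => /=; first by rewrite ltcR.
by move=> xy /=; rewrite -real_ballE; exact: BA.
Qed.

HB.instance Definition _ := Uniform_isPseudoMetric.Build R Y
  real_ball_center real_ball_sym real_ball_triangle real_entourageE.
HB.instance Definition _ := NormedZmod_PseudoMetric_eq.Build R Y erefl.

Fact real_normZ (a : R) (x : Y) : `|a *: x| = `|a| * `|x|.
Proof.
apply: complexI; rewrite rmorphM/= !real_normE normrZ; congr (_ * _).
by rewrite normc_def /= expr0n addr0 sqrtr_sqr.
Qed.
HB.instance Definition _ :=
  PseudoMetricNormedZmod_Lmodule_isNormedModule.Build R Y real_normZ.
End Realification.

(** * The closed graph theorem *)

Section ClosedGraph.
Context {R : realType} {V W : completeNormedModType R}.
Variable T : {linear V -> W}.

(** The space is the union of the sets [E n] where [`|T x| <= n], so by Baire's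
    theorem some closure of [E n] contains a ball.  Subtracting its center moves
    the ball to the origin, at the price of replacing [n] by [n + n], and
    homogeneity does the rest.  The error [e] is what taking closures
    costs; [closed_graph] removes it. *)
Lemma almost_bounded_preimage : exists2 c : R, 0 <= c &
  forall (x : V) e, 0 < e -> exists2 y : V, `|x - y| < e & `|T y| <= c * `|x|.
Proof.
pose E (n : nat) : set V := [set x | `|T x| <= n%:R].
have [n nd] : exists n, ~ dense (~` closure (E n)).
  apply: contrapT => /forallNP H.
  have : dense (\bigcap_n ~` closure (E n)).
    apply: Baire => n; split; last exact: contrapT (H n).
    exact/closed_openC/closed_closure.
  move=> /(_ setT); case; [by exists 0|exact: openT|].
  move=> x [_ /(_ (Num.truncn `|T x|).+1 I)]; apply; apply: subset_closure.
  by rewrite /E /=; exact/ltW/truncnS_gt.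
have [x0 [r r0 Hr]] : exists x0, exists2 r : R, 0 < r & ball x0 r `<=` closure (E n).
  move: nd => /denseNE [U [[x /open_nbhs_nbhs/nbhs_ballP[r r0 bU]] UE]].
  exists x, r => // y /bU Uy; apply: contrapT => nE.
  by have : (U `&` ~` closure (E n)) y by []; rewrite UE.
have small (x : V) e : `|x| < r -> 0 < e -> exists2 y : V, `|x - y| < e & `|T y| <= (n + n)%:R.
  move=> xr e0; have e20 : 0 < e / 2 by rewrite divr_gt0.
  have cl z : ball x0 r z -> exists2 y, `|z - y| < e / 2 & `|T y| <= n%:R.
    move=> /Hr /(_ _ (nbhsx_ballx z _ e20)) [y [Ey]].
    by rewrite -ball_normE => zy; exists y.
  have [|y1 y1x Ty1] := cl (x0 + x).
    by rewrite -ball_normE /ball_ /= opprD addrA subrr add0r normrN.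
  have [|y2 y2x Ty2] := cl x0; first exact: ballxx.
  exists (y1 - y2); last by rewrite linearB natrD (le_trans (ler_normB _ _))// lerD.
  rewrite (_ : x - _ = (x0 + x - y1) - (x0 - y2)).
    by rewrite (le_lt_trans (ler_normB _ _))// (splitr e) ltrD.
  by rewrite !opprB [RHS]addrC -!addrA addKr addrCA.
exists ((n + n)%:R * 2 / r) => [|x e e0].
  by rewrite !mulr_ge0// invr_ge0 ltW.
have [->|x_neq0] := eqVneq x 0.
  by exists 0; rewrite ?subr0 ?normr0// linear0 normr0 mulr0.
have x0' : 0 < `|x| by rewrite normr_gt0.
(* the factor that brings the norm of x to r / 2, inside the ball *)
pose t := r / 2 / `|x|; have t0 : 0 < t by rewrite !divr_gt0.
have [||y yx Ty] := small (t *: x) (t * e).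
- rewrite normrZ gtr0_norm// /t divfK ?gt_eqF// ltr_pdivrMr//.
  by rewrite ltr_pMr// ltr1n.
- exact: mulr_gt0.
exists (t^-1 *: y).
  rewrite -(ltr_pM2l t0) -[X in X * `|_|](gtr0_norm t0) -normrZ.
  by rewrite scalerBr scalerA divff ?gt_eqF// scale1r.
rewrite linearZ normrZ normfV gtr0_norm// ler_pdivrMl//.
apply: le_trans Ty _; rewrite /t le_eqVlt; apply/orP; left; apply/eqP.
by field; rewrite gt_eqF //= gt_eqF.
Qed.

(** Iterating [almost_bounded_preimage] with errors that halve at each step
    writes [x] as the sum of a series [y n] with [`|T (y n)| <= c * `|x| / 2 ^ n].
    The series of the [T (y n)] then converges, to a vector of norm at most
    [2 * c * `|x|], and this limit is [T x] because the graph is closed. *)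
Lemma closed_graph :
  (forall u (x : V) (y : W), u @ \oo --> x -> T \o u @ \oo --> y -> T x = y) ->
  exists C, forall x : V, `|T x| <= C * `|x|.
Proof.
move=> graph; have [c c0 step] := almost_bounded_preimage.
exists (c * 2) => x.
have [->|x_neq0] := eqVneq x 0; first by rewrite linear0 !normr0 mulr0.
have x0 : 0 < `|x| by rewrite normr_gt0.
pose d n : R := `|x| / 2 ^+ n.
have d0 n : 0 < d n by rewrite divr_gt0 ?exprn_gt0.
have stepd n (z : V) : exists y : V, `|z - y| < d n.+1 /\ `|T y| <= c * `|z|.
  by have [y] := step z _ (d0 n.+1); exists y.
have [g gP] := choice (fun nz => stepd nz.1 nz.2).
(* the part of x that the first n terms of the series leave over *)
pose fix rest n := if n is p.+1 then rest p - g (p, rest p) else x.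
pose y n := g (n, rest n).
have restd n : `|rest n| <= d n.
  case: n => [|n]; first by rewrite /d expr0 divr1.
  by have [/ltW] := gP (n, rest n).
have sumy n : series y n = x - rest n.
  elim: n => [|n IH]; first by rewrite seriesEord /= big_ord0 subrr.
  by rewrite seriesSr IH /= /y opprB addrA addrAC.
have dE : d = geometric `|x| 2^-1.
  by apply/funext => n; rewrite /d /= exprVn.
have half1 : `|2^-1 : R| < 1 by rewrite ger0_norm// invf_lt1// ltr1n.
have d_cvg0 : d @ \oo --> 0 by rewrite dE; exact: cvg_geometric.
have rest0 : rest @ \oo --> 0.
  apply/norm_cvg0P; apply: (squeeze_cvgr _ (cvg_cst 0) d_cvg0).
  by apply: nearW => n; rewrite normr_ge0 restd.
have sum_x : series y @ \oo --> x.
  rewrite (_ : series y = (fun n => x - rest n)); last exact/funext.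
  by rewrite -[X in _ --> X]subr0; apply: cvgB => //; exact: cvg_cst.
have Ty n : `|T (y n)| <= geometric (c * `|x|) 2^-1 n.
  have [_ /le_trans] := gP (n, rest n); apply.
  by rewrite /= exprVn -mulrA ler_wpM2l// restd.
have cvgT : cvgn [normed series (T \o y)].
  apply: series_le_cvg Ty _ => //.
    by move=> n; rewrite /= !mulr_ge0// exprn_ge0.
  exact: is_cvg_geometric_series.
have -> : T x = limn (series (T \o y)).
  apply: graph sum_x _.
  rewrite (_ : T \o series y = series (T \o y)); first exact: normed_cvg.
  by apply/funext => n; rewrite /= !seriesEord /= linear_sum.
apply: le_trans (lim_series_norm cvgT) _.
have -> : c * 2 * `|x| = c * `|x| / (1 - 2^-1) by field.
have := @cvg_geometric_series R (c * `|x|) _ half1 => gl.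
rewrite -(cvg_lim _ gl)//; apply: (ler_lim cvgT); first exact: cvgP gl.
by apply: nearW => n; apply: ler_sum => i _; exact: Ty.
Qed.
End ClosedGraph.

(** * The Hahn-Banach theorem *)

Section HahnBanach.
Context {R : realType} {V : lmodType R}.
Implicit Types (p q : V -> R) (x y z : V) (t : R).

(** Only the inequality is required for homogeneity, since that is what is easy
    to check; equality follows ([sublinearZ]). *)
Definition sublinear q : Prop :=
  (forall x y, q (x + y) <= q x + q y) /\
  (forall t x, 0 <= t -> q (t *: x) <= t * q x).

Lemma sublinearZ q t x : sublinear q -> 0 <= t -> q (t *: x) = t * q x.
Proof.
move=> [qD qZ]; rewrite le_eqVlt => /predU1P[<-|t0].
  rewrite mul0r scale0r; apply/eqP; rewrite eq_le.
  have := qZ 0 0 (lexx 0); rewrite scale0r mul0r => -> /=.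
  by have := qD 0 0; rewrite addr0 lerDl.
apply/eqP; rewrite eq_le qZ ?(ltW t0)//= -ler_pdivlMl//.
by rewrite -[X in q X <= _](scalerK (lt0r_neq0 t0)) qZ// invr_ge0 ltW.
Qed.

Lemma sublinear_oppr q x : sublinear q -> - q (- x) <= q x.
Proof.
move=> sq; have q0 : q 0 = 0.
  by have := sublinearZ 0 sq (lexx 0); rewrite scaler0 mul0r.
by rewrite -subr_ge0 opprK -q0 -[X in q X](subrr x) sq.1.
Qed.

(** A modification of [q] that stays sublinear and below [q] while its value at
    [- z] drops to [- q z], the smallest value that [sublinear_oppr] permits.
    A sublinear functional that cannot be lowered in this way for any [z] is
    odd, hence linear. *)
Definition lower_along q z x : R :=
  inf [set q (x + t *: z) - t * q z | t in [set t | 0 <= t]].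

Section LowerAlong.
Variables (q : V -> R) (z : V).
Hypothesis sq : sublinear q.

Lemma lower_along_le x t : 0 <= t ->
  lower_along q z x <= q (x + t *: z) - t * q z.
Proof.
move=> t0; apply: ge_inf; last by exists t.
exists (- q (- x)) => _ [s /= s0 <-].
have := sq.1 (x + s *: z) (- x).
by rewrite addrAC subrr add0r sublinearZ//; lra.
Qed.

Lemma lower_along_ge x m :
  (forall t, 0 <= t -> m <= q (x + t *: z) - t * q z) ->
  m <= lower_along q z x.
Proof.
move=> mq; apply: lb_le_inf; last by move=> _ [t t0 <-]; exact: mq.
by exists (q (x + 0 *: z) - 0 * q z), 0 => /=.
Qed.

Lemma lower_along_le_self x : lower_along q z x <= q x.
Proof.
by have := @lower_along_le x 0 (lexx 0); rewrite scale0r addr0 mul0r subr0.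
Qed.

Lemma lower_along_opp : lower_along q z (- z) <= - q z.
Proof.
apply: le_trans (lower_along_le _ ler01) _.
rewrite scale1r mul1r addNr.
by have := sublinearZ 0 sq (lexx 0); rewrite scaler0 mul0r => ->; rewrite sub0r.
Qed.

Lemma lower_along_sublinear : sublinear (lower_along q z).
Proof.
split=> [x y|t x].
  rewrite -lerBlDr; apply: lower_along_ge => s s0.
  rewrite lerBlDr -lerBlDl; apply: lower_along_ge => t t0.
  have := lower_along_le (x + y) (addr_ge0 s0 t0).
  have := sq.1 (x + s *: z) (y + t *: z).
  by rewrite addrACA -scalerDl mulrDl; lra.
rewrite le_eqVlt => /predU1P[<-|t0].
  rewrite scale0r mul0r; apply: le_trans (lower_along_le _ (lexx 0)) _.
  by rewrite scale0r mul0r addr0 subr0 -(scale0r 0) sublinearZ// mul0r.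
rewrite -ler_pdivrMl//; apply: lower_along_ge => s s0.
rewrite ler_pdivrMl// mulrBr -(sublinearZ _ sq (ltW t0)) scalerDr scalerA mulrA.
by apply: lower_along_le; rewrite mulr_ge0// ltW.
Qed.
End LowerAlong.

(** Zorn's lemma: the pointwise infimum of a chain of sublinear functionals
    below [p] is sublinear, and it is finite since all of them are at least
    [- p (- x)] at [x]. *)
Lemma minimal_sublinear p : sublinear p -> exists q,
  [/\ sublinear q, forall x, q x <= p x &
    forall q', sublinear q' -> (forall x, q' x <= q x) -> q' = q].
Proof.
move=> sp.
pose T := {q : V -> R | sublinear q /\ forall x, q x <= p x}.
pose r (a b : T) := `[< forall x, sval b x <= sval a x >].
have [|||A totA|[q [sq qp]] qmin] := @Zorn T r.
- by move=> a; apply/asboolP.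
- move=> a b c /asboolP ab /asboolP bc; apply/asboolP => x.
  exact: le_trans (bc x) (ab x).
- move=> [a Pa] [b Pb] /asboolP ab /asboolP ba; apply/eq_exist/funext => x.
  by apply/eqP; rewrite eq_le (ab x) (ba x).
- have [A0|/set0P[a0 Aa0]] := eqVneq A set0.
    by exists (exist _ p (conj sp (fun x => lexx _))) => s; rewrite A0.
  have bnd x : has_lbound [set sval a x | a in A].
    exists (- p (- x)) => _ [[a [sa ap]] _ <-] /=.
    by apply: le_trans (sublinear_oppr x sa); rewrite lerN2.
  pose m x := inf [set sval a x | a in A].
  have m_le a x : A a -> m x <= sval a x.
    by move=> Aa; apply: ge_inf; [exact: bnd|exists a].
  have le_m x c : (forall a, A a -> c <= sval a x) -> c <= m x.
    move=> H; apply: lb_le_inf; first by exists (sval a0 x), a0.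
    by move=> _ [a Aa <-]; exact: H.
  have sm : sublinear m.
    split=> [x y|t x].
      rewrite -lerBlDr; apply/le_m => a Aa.
      rewrite lerBlDr -lerBlDl; apply/le_m => b Ab; rewrite lerBlDl.
      (* the smaller of the two members a and b bounds m at x + y *)
      wlog /asboolP ab : x y a b Aa Ab / r a b.
        move=> H; have [ab|ba] := totA a b Aa Ab; first exact: (H x y).
        by rewrite addrC [X in _ <= X]addrC; exact: (H y x).
      apply: le_trans (m_le b (x + y) Ab) _.
      by apply: le_trans ((svalP b).1.1 x y) _; rewrite lerD2r.
    rewrite le_eqVlt => /predU1P[<-|t0].
      apply: le_trans (m_le a0 _ Aa0) _.
      by rewrite (sublinearZ _ (svalP a0).1)// !mul0r.
    rewrite -ler_pdivrMl//; apply/le_m => a Aa; rewrite ler_pdivrMl//.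
    rewrite -(sublinearZ _ (svalP a).1) ?(ltW t0)//; exact: m_le.
  have mp x : m x <= p x by apply: le_trans (m_le a0 x Aa0) ((svalP a0).2 x).
  by exists (exist _ m (conj sm mp)) => a Aa; apply/asboolP => x; exact: m_le.
exists q; split => // q' sq' q'q.
have q'p x : q' x <= p x := le_trans (q'q x) (qp x).
have /qmin/(congr1 sval)// : r (exist _ q (conj sq qp)) (exist _ q' (conj sq' q'p)).
exact/asboolP.
Qed.

(** A minimal sublinear functional is linear.  Taking it below
    [lower_along p z] and not merely below [p] forces the value [p z] at [z]. *)
Theorem hahn_banach p z : sublinear p ->
  exists f : V -> R, [/\ scalar f, forall x, f x <= p x & f z = p z].
Proof.
move=> sp.
have [f [sf fq fmin]] := minimal_sublinear (lower_along_sublinear z sp).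
have fp x : f x <= p x by apply: le_trans (fq x) (lower_along_le_self z sp x).
have fN x : f (- x) = - f x.
  apply/eqP; rewrite eq_le andbC lerNl sublinear_oppr//=.
  have {1}<- := fmin _ (lower_along_sublinear x sf) (lower_along_le_self x sf).
  exact: lower_along_opp.
have fD x y : f (x + y) = f x + f y.
  apply/eqP; rewrite eq_le sf.1/= -lerN2 -fN !opprD -!fN; exact: sf.1.
have fZ t x : f (t *: x) = t * f x.
  have [t0|t0] := leP 0 t; first exact: sublinearZ.
  rewrite -[t]opprK scaleNr fN sublinearZ ?mulNr//.
  by rewrite oppr_ge0 ltW.
exists f; split => //; first by move=> t x y; rewrite fD fZ.
apply/eqP; rewrite eq_le fp /= -lerN2 -fN.
exact: le_trans (fq _) (lower_along_opp z sp).
Qed.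
End HahnBanach.

(** * Separation of a point from a closed subspace *)

Lemma is_subspaceP (K : pzRingType) (X : lmodType K) (A : set X) :
  is_subspace A <-> A 0 /\ forall a x y, A x -> A y -> A (a *: x + y).
Proof.
split=> [[]|[A0 AD]]; rewrite /in_mem /=.
  rewrite !inE => A0 AD; split=> // a x y Ax Ay.
  by have := AD a x y; rewrite !inE; apply.
by split; rewrite ?inE// => a x y; rewrite !inE; exact: AD.
Qed.

Section Separation.
Context {R : realType}.

(** Hahn-Banach for the distance to [M], which is sublinear, bounded by the norm,
    zero on [M] and, because [M] is closed, nonzero at [z]. *)
Lemma real_separation (V : normedModType R) (M : set V) z :
  is_subspace M -> closed M -> ~ M z ->
  exists f : V -> R, [/\ scalar f, forall x, `|f x| <= `|x|,
    forall x, M x -> f x = 0 & f z != 0].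
Proof.
move=> /is_subspaceP[M0 MD] cM Mz.
pose d x := inf [set `|x - m| | m in M].
have d_le x m : M m -> d x <= `|x - m|.
  by move=> Mm; apply: ge_inf; [exists 0 => _ [? _ <-]|exists m].
have le_d x c : (forall m, M m -> c <= `|x - m|) -> c <= d x.
  move=> H; apply: lb_le_inf; first by exists `|x - 0|, 0.
  by move=> _ [m Mm <-]; exact: H.
have sd : sublinear d.
  split=> [x y|t x].
    rewrite -lerBlDr; apply/le_d => m Mm; rewrite lerBlDr -lerBlDl.
    apply/le_d => n Mn; rewrite lerBlDl.
    have /d_le/le_trans -> // : M (m + n) by have := MD 1 m n; rewrite scale1r; apply.
    by rewrite opprD addrACA ler_normD.
  rewrite le_eqVlt => /predU1P[<-|t0].
    by rewrite scale0r mul0r; have := d_le 0 0 M0; rewrite subr0 normr0.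
  rewrite -ler_pdivrMl//; apply/le_d => m Mm; rewrite ler_pdivrMl//.
  have /d_le/le_trans -> // : M (t *: m) by have := MD t m 0; rewrite addr0; apply.
  by rewrite -scalerBr normrZ gtr0_norm.
have [f [lf fd fz]] := hahn_banach z sd.
have fN x : f (- x) = - f x.
  have := lf 1 0 0; have := lf (- 1) x 0.
  by rewrite scaler0 !addr0 scaleN1r mulN1r mul1r; lra.
have d_norm x : d x <= `|x| by have := d_le x 0 M0; rewrite subr0.
exists f; split=> //.
- move=> x; rewrite ler_norml lerNl -fN -[X in f (- x) <= X]normrN.
  by rewrite !(le_trans (fd _)).
- move=> x Mx; apply/eqP; rewrite -normr_le0 ler_norml lerNl -fN.
  have dM y : M y -> d y <= 0 by move=> /(d_le y); rewrite subrr normr0.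
  rewrite !(le_trans (fd _))// dM//.
  by have := MD (-1) x 0; rewrite addr0 scaleN1r; apply.
- rewrite fz; apply: contra_notN Mz => /eqP dz.
  apply: cM => U /nbhs_ballP[e /= e0 eU].
  have [m [Mm]] : exists m, M m /\ `|z - m| < e.
    apply: contrapT => /forallNP H; suff : e <= d z by rewrite dz leNgt e0.
    by apply/le_d => m Mm; rewrite leNgt; apply/negP => zm; apply: (H m).
  by exists m; split => //; apply: eU; rewrite -ball_normE.
Qed.

Definition bounded_functional (K : numFieldType) (X : normedModType K) (f : X -> K) :=
  scalar f /\ exists2 C : K, 0 <= C & forall x, `|f x| <= C * `|x|.

Lemma bounded_functionalZ (K : numFieldType) (X : normedModType K) (f : X -> K) c :
  bounded_functional f -> bounded_functional (fun x => c * f x).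
Proof.
move=> [lf [C C0 fC]]; split; first by move=> a x y; rewrite lf mulrDr mulrCA.
exists (`|c| * C) => [|x]; first exact: mulr_ge0.
by rewrite normrM -mulrA ler_wpM2l.
Qed.

(** In the complex case a real functional [f] is completed to the complex
    functional [x |-> f x - i f (i x)]. *)
Lemma separation (k : scalar_kind) (X : completeNormedModType (scalars R k))
    (M : set X) z : closed_subspace M -> ~ M z ->
  exists f : X -> scalars R k,
    [/\ bounded_functional f, forall x, M x -> f x = 0 & f z = 1].
Proof.
move=> sM Mz.
suff [f [bf fM fz]] : exists f : X -> scalars R k,
    [/\ bounded_functional f, forall x, M x -> f x = 0 & f z != 0].
  exists (fun x => (f z)^-1 * f x); split; first exact: bounded_functionalZ.
    by move=> x /fM ->; rewrite mulr0.
  exact: mulVf.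
case: k => /= in X M z sM Mz *.
  have [f [lf fb fM fz]] := real_separation sM.1 sM.2 Mz.
  exists f; split => //; split => //; exists 1 => // x; rewrite mul1r; exact: fb.
have /is_subspaceP[M0 MD] := sM.1.
have sM' : is_subspace (M : set (realified X)).
  by apply/is_subspaceP; split; [exact: M0|move=> a x y; exact: MD].
have [f [lf fb fM fz]] := @real_separation (realified X) M z sM' sM.2 Mz.
have f0 : f (0 : X) = 0 by exact: fM.
have fD (x y : X) : f (x + y) = f x + f y.
  by have := lf 1 x y; rewrite scale1r mul1r.
have fZ (a : R) (x : X) : f (real_complex R a *: x) = a * f x.
  by have := lf a x 0; rewrite addr0 f0 addr0.
have fC (a b : R) (x : X) : f (Complex a b *: x) = a * f x + b * f ('i%C *: x).
  by rewrite [Complex a b]complexE scalerDl fD fZ (mulrC 'i%C) -scalerA fZ.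
pose F (x : X) : R[i] := Complex (f x) (- f ('i%C *: x)).
exists F; split.
- split.
    move=> [a b] x y; rewrite /F scalerDr !fD scalerA.
    have -> : 'i%C * Complex a b = Complex (- b) a by simpc.
    rewrite (fC a b) (fC (- b) a); apply/eqP; rewrite eq_complex /=.
    by apply/andP; split; apply/eqP; ring.
  (* each of the two real components of F x is at most the norm of x *)
  exists 2 => // x.
  have fx (y : X) : real_complex R `|f y| <= `|y|.
    by rewrite -(real_normE (y : realified X)) lecR; exact: fb.
  rewrite mulr2n mulrDl mul1r.
  have nC (u v : R) : `|Complex u v| <= real_complex R `|u| + real_complex R `|v|.
    rewrite [Complex u v]complexE /= (le_trans (ler_normD _ _))// normrM.
    by rewrite !normc_def /= !expr0n /= expr1n !addr0 add0r sqrtr1 !sqrtr_sqr mul1r.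
  apply: le_trans (nC _ _) _; rewrite normrN lerD//.
  apply: le_trans (fx _) _; rewrite normrZ.
  by rewrite normc_def /= expr0n expr1n /= add0r sqrtr1 mul1r.
- by move=> x Mx; rewrite /F !fM ?oppr0//; have := MD 'i%C x 0; rewrite addr0; apply.
- by apply: contraNneq fz => /(congr1 (@complex.Re R)) /= ->.
Qed.
End Separation.

(** * Bounded projections onto complemented subspaces *)

Section Projection.
Context {R : realType}.

Lemma closed_graph_bounded (k : scalar_kind)
    (X : completeNormedModType (scalars R k)) (T : X -> X) :
  linear T ->
  (forall u (x y : X), u @ \oo --> x -> T \o u @ \oo --> y -> T x = y) ->
  bounded_linear T.
Proof.
move=> lT graph; split => //; case: k => /= in X T lT graph *.
  pose T' : {linear X -> X} := HB.pack T (GRing.isLinear.Build _ _ _ _ T lT).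
  have [C TC] := closed_graph (T := T') graph.
  exists `|C| => // x; apply: le_trans (TC x) _.
  by rewrite ler_wpM2r// ler_norm.
have lT' : linear (T : realified X -> realified X) by move=> a x y; exact: lT.
pose T' : {linear realified X -> realified X} :=
  HB.pack (T : realified X -> realified X) (GRing.isLinear.Build _ _ _ _ _ lT').
have [C TC] := closed_graph (T := T') graph.
exists (real_complex R `|C|); first by rewrite ler0c.
move=> x; rewrite -!(real_normE (_ : realified X)) -rmorphM lecR.
by apply: le_trans (TC x) _; rewrite ler_wpM2r// ler_norm.
Qed.

(** The projection along a closed complement has a closed graph: if [u] tends to
    [x] and [P u] to [y], then [y] is in [N] and [x - y] in the complement. *)
Lemma complemented_projection (k : scalar_kind)
    (X : completeNormedModType (scalars R k)) (N : set X) :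
  closed_subspace N -> complemented N ->
  exists P, [/\ bounded_linear P, forall x, N (P x) & forall x, N x -> P x = x].
Proof.
move=> [/is_subspaceP[N0 ND] cN] [M [[/is_subspaceP[M0 MD] cM] NM dec]].
have /choice[P PP] x : exists y, N y /\ M (x - y).
  have [y [z [Ny Mz ->]]] := dec x; exists y; split => //.
  by rewrite addrAC subrr add0r.
have uniq x y : N y -> M (x - y) -> P x = y.
  move=> Ny Mxy; have [NP MP] := PP x; apply/eqP; rewrite -subr_eq0; apply/eqP.
  suff : (N `&` M) (P x - y) by rewrite NM.
  split; first by have := ND (-1) y (P x); rewrite scaleN1r addrC; apply.
  have := MD (-1) (x - P x) (x - y) MP Mxy.
  by rewrite scaleN1r opprB addrA subrK.
have PN x : N (P x) by have [] := PP x.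
exists P; split => //; last first.
  by move=> x Nx; apply: uniq => //; rewrite subrr.
apply: closed_graph_bounded.
  move=> a x y; apply: uniq; first exact: ND.
  by rewrite opprD addrACA -scalerBr; apply: MD; have [] := PP x; have [] := PP y.
move=> u x y ux Py; apply: uniq.
  by apply: (closed_cvg _ cN) Py; apply: nearW => n; exact: PN.
apply: (closed_cvg _ cM) (cvgB ux Py); apply: nearW => n.
by have [] := PP (u n).
Qed.
End Projection.

(** * Maps that preserve principal ideals *)

Section LocalCentralizers.
Context {A : pzRingType}.
Variable psi : A -> A.
Hypothesis psiD : {morph psi : a b / a + b}.

(** What preserving the principal right ideals [a A] amounts to. *)
Definition local_right_centralizer : Prop := forall a b, exists c, psi (a * b) = a * c.

(** In [e * psi a = e * psi (e * a) + e * psi ((1 - e) * a)] the first term is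
    [psi (e * a)], as this lies in [e A], and the second one is zero, as
    [psi ((1 - e) * a)] lies in [(1 - e) A]. *)
Lemma local_right_centralizer_idempotent e a :
  local_right_centralizer -> e * e = e -> psi (e * a) = e * psi a.
Proof.
move=> loc ee; have [c ec] := loc e a; have [d ed] := loc (1 - e) a.
have -> : psi a = psi (e * a) + psi ((1 - e) * a).
  by rewrite -psiD -mulrDl subrKC mul1r.
by rewrite mulrDr ec ed !mulrA mulrBr mulr1 ee subrr mul0r addr0.
Qed.
End LocalCentralizers.

(** * Nests *)

Section Nests.
Context {K : numFieldType} {X : completeNormedModType K}.
Implicit Types (M Z : set X) (G : set (set X)).

Lemma closed_join_min G Z : closed_subspace Z ->
  (forall M, G M -> M `<=` Z) -> closed_join G `<=` Z.
Proof.
move=> [sZ cZ] GZ; rewrite /closed_join closureE => x; apply; split => //.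
move=> y; apply; split => // z [M GM]; exact: GZ.
Qed.

Lemma closed_join_sup G M : G M -> M `<=` closed_join G.
Proof.
move=> GM x Mx; apply: subset_closure => Z [_]; apply; by exists M.
Qed.

Lemma kernel_closed_subspace (T : X -> X) :
  bounded_linear T -> closed_subspace [set x | T x = 0].
Proof.
move=> [lT [C C0 TC]].
have TB x y : T (x - y) = T x - T y.
  by rewrite addrC -scaleN1r lT scaleN1r addrC.
split.
  apply/is_subspaceP; split => [|a x y Tx Ty] /=.
    by have := TB 0 0; rewrite !subrr.
  by rewrite lT Tx Ty scaler0 addr0.
move=> p clp /=; apply/eqP; rewrite -normr_eq0; apply: contraT => Tp.
have Tp0 : 0 < `|T p| by rewrite normr_gt0 -normr_eq0.
have C1 : 0 < C + 1 by rewrite ltr_wpDl.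
have [q [/= Tq]] := clp _ (nbhsx_ballx p _ (divr_gt0 Tp0 C1)).
rewrite -ball_normE /ball_ /= ltr_pdivlMr// => pq.
have := TC (p - q); rewrite TB Tq subr0 => /le_lt_trans/(_ (le_lt_trans _ pq)).
rewrite ltxx; apply; rewrite mulrC.
by rewrite ler_wpM2l// lerDl.
Qed.

Variable N : nest X.

Lemma nest_closed_subspace M : nest_set N M -> closed_subspace M.
Proof. by have [+ _ _ _ _] := nestP N; exact. Qed.

Lemma nest_pred_mem M : nest_set N (nest_pred N M).
Proof. by have [_ _ _ _] := nestP N; apply => Z []. Qed.

Lemma nest_pred_sub M : nest_set N M -> nest_pred N M `<=` M.
Proof.
move=> NM; apply: closed_join_min; first exact: nest_closed_subspace.
by move=> Z [_ /properW].
Qed.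

Lemma nest_pred_gap M : nest_set N M -> nest_pred N M <> M ->
  exists2 x, M x & ~ nest_pred N M x.
Proof.
move=> NM MM; apply: contrapT => H; apply: MM; apply/seteqP.
split; first exact: nest_pred_sub.
by move=> x Mx; apply: contrapT => Px; apply: H; exists x.
Qed.

(** The dichotomy behind the invariance of rank-one operators. *)
Lemma nest_sub_or_pred M Z : nest_set N M -> nest_set N Z ->
  M `<=` Z \/ Z `<=` nest_pred N M.
Proof.
move=> NM NZ; have [_ tot _ _ _] := nestP N.
have [MZ|MZ] := pselect (M `<=` Z); [by left|right].
apply: closed_join_sup; split => //; split => //.
by have [|//] := tot _ _ NM NZ.
Qed.

(** Let [L] be the intersection of the nonzero members of the nest.  If [L] is
    zero, then [x] is outside some nonzero [M], hence outside [M_-].  If not, [L] is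
    the smallest nonzero member, so [L_-] is zero. *)
Lemma nest_pred_separates x : x != 0 ->
  exists M, [/\ nest_set N M, M <> [set 0] & ~ nest_pred N M x].
Proof.
move=> x0; have [_ _ _ cap _] := nestP N.
pose G := [set M | nest_set N M /\ M <> [set 0]].
have NL : nest_set N (\bigcap_(M in G) M) by apply: cap => M [].
set L := \bigcap_(M in G) M in NL.
have [L0|L0] := pselect (L = [set 0]).
  have : ~ L x by rewrite L0 => /= xE; rewrite xE eqxx in x0.
  move=> /existsNP[M /not_implyP[[NM M0] Mx]].
  by exists M; split => // /(nest_pred_sub NM).
exists L; split => //.
have [_ _ [/nest_closed_subspace s0 _] _ _] := nestP N.
suff sub : nest_pred N L `<=` [set 0] by move=> /sub /= xE; rewrite xE eqxx in x0.
apply: closed_join_min => // M [NM [ML LM]].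
apply: contrapT => M0; apply: LM => y; apply; split => // ME.
by apply: M0; rewrite ME.
Qed.

(** If [X_- <> X], take [M = X].  If [X_- = X], then [X] is the join of the
    members [M <> X], and these satisfy [M_- <> X] because [M_-] is inside [M]. *)
Lemma nest_join_full Z : closed_subspace Z ->
  (forall M, nest_set N M -> nest_pred N M <> setT -> M `<=` Z) -> Z = setT.
Proof.
move=> sZ NZ; have [_ _ [_ NT] _ _] := nestP N.
apply/seteqP; split => // x _.
have [XX|XX] := pselect (nest_pred N setT = setT); last exact: (NZ setT).
have : nest_pred N setT x by rewrite XX.
apply: closed_join_min => // M [NM [_ TM]]; apply: NZ => // MT.
by apply: TM => y _; apply: nest_pred_sub NM _ _; rewrite MT.
Qed.

End Nests.

(** * Idempotents and rank-one operators of a nest algebra *)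

Section NestAlgebra.
Context {K : numFieldType} {X : completeNormedModType K}.
Variable N : nest X.
Local Notation A := (nest_alg N).
Implicit Types (M : set X) (a b e r : A).

Lemma nest_op_linear a : bounded_linear a.
Proof. by have /set_mem[] := nest_opP a. Qed.

Lemma nest_op_invariant a M x : nest_set N M -> M x -> M (a x).
Proof. by move=> NM Mx; have /set_mem[_ aN] := nest_opP a; exact: aN NM _ Mx. Qed.

Lemma nest_op0 a : a 0 = 0.
Proof.
by have [la _] := nest_op_linear a; have := la (- 1) 0 0; rewrite scaler0 addr0 scaleN1r addNr.
Qed.

Lemma nest_opZ a c x : a (c *: x) = c *: a x.
Proof. by have [la _] := nest_op_linear a; have := la c x 0; rewrite nest_op0 !addr0. Qed.

Lemma nest_scalerAl c a b : c *: (a * b) = (c *: a) * b.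
Proof. exact: val_inj. Qed.

Lemma nest_scalerAr c a b : c *: (a * b) = a * (c *: b).
Proof. by apply/val_inj/funext => x; change (c *: a (b x) = a (c *: b x)); rewrite nest_opZ. Qed.

Lemma right_ideal_preserving_local psi : right_ideal_preserving psi ->
  local_right_centralizer (psi : A -> A).
Proof.
move=> pres a b.
have ideal : right_ideal [set a * c | c in [set: A]].
  split.
    apply/is_subspaceP; split; first by exists 0; rewrite ?mulr0.
    move=> c _ _ [x _ <-] [y _ <-]; exists (c *: x + y) => //.
    by rewrite mulrDr nest_scalerAr.
  by move=> _ c [x _ <-]; exists (x * c) => //; rewrite mulrA.
have [|c _ <-] := pres _ ideal (psi (a * b)); last by exists c.
by exists (a * b) => //; exists b.
Qed.

(** Left ideals of [A] are right ideals of the converse ring [A^c]. *)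
Lemma left_ideal_preserving_local psi : left_ideal_preserving psi ->
  local_right_centralizer (psi : A^c -> A^c).
Proof.
move=> pres a b.
have ideal : left_ideal [set c * (a : A) | c in [set: A]].
  split.
    apply/is_subspaceP; split; first by exists 0; rewrite ?mul0r.
    move=> c _ _ [x _ <-] [y _ <-]; exists (c *: x + y) => //.
    by rewrite mulrDl nest_scalerAl.
  by move=> c _ [x _ <-]; exists (c * x) => //; rewrite mulrA.
have [|c _ <-] := pres _ ideal (psi ((b : A) * (a : A))); last by exists c.
by exists ((b : A) * (a : A)) => //; exists b.
Qed.

(** Differences are enough for all the rank-one operators needed below. *)
Definition idempotent_combination r : Prop :=
  exists c d e e', [/\ e * e = e, e' * e' = e' & r = c *: e - d *: e'].

Lemma idempotent_combination_right (psi : {linear A -> A}) r :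
  right_ideal_preserving psi -> idempotent_combination r ->
  forall a, psi (r * a) = r * psi a.
Proof.
move=> /right_ideal_preserving_local loc [c [d [e [e' [ee ee' ->]]]]] a.
have E := fun u uu => local_right_centralizer_idempotent (e := u) (linearD psi) a loc uu.
by rewrite !mulrBl -!nest_scalerAl linearB !linearZ /= !E.
Qed.

Lemma idempotent_combination_left (psi : {linear A -> A}) r :
  left_ideal_preserving psi -> idempotent_combination r ->
  forall a, psi (a * r) = psi a * r.
Proof.
move=> /left_ideal_preserving_local loc [c [d [e [e' [ee ee' ->]]]]] a.
have E u : u * u = u -> psi (a * u) = psi a * u.
  exact: (@local_right_centralizer_idempotent A^c psi (linearD psi) u a loc).
by rewrite !mulrBr -!nest_scalerAr linearB !linearZ /= !E.
Qed.

Definition annihilates (f : X -> K) M : Prop := forall x, M x -> f x = 0.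

(** A member [Z] of the nest either contains [M], hence [x], or lies inside
    [M_-], where [f] vanishes; it is invariant in both cases. *)
Lemma rank_one_exists M x f : nest_set N M -> M x -> bounded_functional f ->
  annihilates f (nest_pred N M) -> exists r : A, forall y, r y = f y *: x.
Proof.
move=> NM Mx [lf [C C0 fC]] fM.
suff rP : (fun y => f y *: x) \in alg_pred N by exists (NestAlg rP).
rewrite inE; split; first split.
- by move=> a y z; rewrite lf scalerDl scalerA.
- exists (C * `|x|) => [|y]; first exact: mulr_ge0.
  by rewrite normrZ mulrAC ler_wpM2r.
move=> Z NZ y Zy; have /is_subspaceP[Z0 ZD] := (nest_closed_subspace NZ).1.
have [/(_ x Mx) Zx|ZM] := nest_sub_or_pred NM NZ.
  by have := ZD (f y) x 0 Zx Z0; rewrite addr0.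
by rewrite fM ?scale0r//; exact: ZM.
Qed.

End NestAlgebra.

Section RankOne.
Context {K : numFieldType} {X : completeNormedModType K}.
Variable N : nest X.
Local Notation A := (nest_alg N).
Implicit Types (M : set X) (f g : X -> K) (x y : X) (r e : A).

Lemma rank_one_scaled_idempotent r f x : (forall y, r y = f y *: x) ->
  bounded_functional f -> f x != 0 ->
  exists2 e : A, e * e = e & r = f x *: e.
Proof.
move=> rE [lf _] fx; have f0 : f 0 = 0.
  by have := lf (-1) 0 0; rewrite scaler0 addr0 mulN1r addNr.
have fZ c y : f (c *: y) = c * f y by have := lf c y 0; rewrite f0 !addr0.
exists ((f x)^-1 *: r); last by rewrite scalerA divff// scale1r.
rewrite -nest_scalerAl; congr (_ *: _); apply/val_inj/funext => y.
change (r ((f x)^-1 *: r y) = r y).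
by rewrite rE fZ rE fZ mulrCA mulVf// mulr1.
Qed.

Lemma nest_op_eq r r' : (forall y, r y = r' y) -> r = r'.
Proof. by move=> rr; exact/val_inj/funext. Qed.

Lemma rank_one_combination_idempotent r f x : (forall y, r y = f y *: x) ->
  bounded_functional f -> f x != 0 -> idempotent_combination r.
Proof.
move=> rE bf fx; have [e ee ->] := rank_one_scaled_idempotent rE bf fx.
by exists (f x), 0, e, e; rewrite scale0r subr0.
Qed.

(** Here [x] is outside [M_-], as [g] shows; if [f x = 0], the operator is the
    difference of those given by [f + g] and [g], which do not vanish at [x]. *)
Lemma rank_one_combination_vector M r f g x : nest_set N M -> M x ->
  bounded_functional f -> bounded_functional g ->
  annihilates f (nest_pred N M) -> annihilates g (nest_pred N M) ->
  g x != 0 -> (forall y, r y = f y *: x) -> idempotent_combination r.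
Proof.
move=> NM Mx bf bg fM gM gx rE.
have [fx|] := eqVneq (f x) 0; last exact: rank_one_combination_idempotent.
have [s sE] := rank_one_exists NM Mx bg gM.
have [e ee s_e] := rank_one_scaled_idempotent sE bg gx.
have rsE y : (r + s) y = (f y + g y) *: x.
  by rewrite scalerDl -rE -sE.
have bfg : bounded_functional (fun y => f y + g y).
  have [[lf [C C0 fC]] [lg [D D0 gD]]] := (bf, bg); split.
    by move=> a y z; rewrite lf lg mulrDr addrACA.
  exists (C + D) => [|y]; first exact: addr_ge0.
  by rewrite mulrDl (le_trans (ler_normD _ _))// lerD.
have [|e' ee' rs_e'] := rank_one_scaled_idempotent rsE bfg; first by rewrite fx add0r.
by exists (f x + g x), (g x), e', e; split => //; rewrite -rs_e' -s_e addrK.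
Qed.

(** The dual of [rank_one_combination_vector]: if [f x = 0], the operator is the
    difference of those given by [x + y] and [y], where [f] does not vanish. *)
Lemma rank_one_combination_functional M r f x y : nest_set N M -> M x -> M y ->
  bounded_functional f -> annihilates f (nest_pred N M) -> f y != 0 ->
  (forall z, r z = f z *: x) -> idempotent_combination r.
Proof.
move=> NM Mx My bf fM fy rE.
have [fx|] := eqVneq (f x) 0; last exact: rank_one_combination_idempotent.
have [s sE] := rank_one_exists NM My bf fM.
have [e ee s_e] := rank_one_scaled_idempotent sE bf fy.
have rsE z : (r + s) z = f z *: (x + y) by rewrite scalerDr -rE -sE.
have fxy : f (x + y) = f y.
  by have := bf.1 1 x y; rewrite scale1r mul1r fx add0r.
have [|e' ee' rs_e'] := rank_one_scaled_idempotent rsE bf; first by rewrite fxy.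
by exists (f y), (f y), e', e; split => //; rewrite -{1}fxy -rs_e' -s_e addrK.
Qed.

(** Every projection [p] onto a member of the nest leaves the nest invariant.
    As [p r = r] and [r p = 0], hence [r r = 0], also [p + r] is idempotent,
    and [r] is the difference of [p + r] and [p]. *)
Lemma rank_one_combination_projection M r f x P : nest_set N M -> M x ->
  annihilates f M -> bounded_linear P -> (forall y, M (P y)) ->
  (forall y, M y -> P y = y) ->
  (forall y, r y = f y *: x) -> idempotent_combination r.
Proof.
move=> NM Mx fM [lP bP] MP PM rE.
have PA : P \in alg_pred N.
  rewrite inE; split => // Z NZ y Zy; have [_ tot _ _ _] := nestP N.
  have [ZM|MZ] := tot _ _ NZ NM; last exact: MZ.
  by rewrite PM//; exact: ZM.
pose p : A := NestAlg PA.
have pp : p * p = p by apply: nest_op_eq => y; exact: PM.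
have pr : p * r = r.
  apply: nest_op_eq => y; change (P (r y) = r y); apply: PM; rewrite rE.
  have /is_subspaceP[M0 MD] := (nest_closed_subspace NM).1.
  by have := MD (f y) x 0 Mx M0; rewrite addr0.
have rp : r * p = 0.
  by apply: nest_op_eq => y; change (r (P y) = 0); rewrite rE fM ?scale0r.
have rr : r * r = 0 by rewrite -{2}pr mulrA rp mul0r.
exists 1, 1, (p + r), p; split => //.
  by rewrite mulrDl !mulrDr pp pr rp rr !addr0.
by rewrite !scale1r addrC addKr.
Qed.
End RankOne.

(** * Ideal preserving maps are centralizers *)

Section Centralizers.
Context {R : realType} {k : scalar_kind} {X : completeNormedModType (scalars R k)}.
Variable N : nest X.
Hypothesis compl :
  forall M : set X, nest_set N M -> nest_pred N M = M -> complemented M.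
Local Notation A := (nest_alg N).
Local Notation K := (scalars R k).
Implicit Types (M : set X) (f : X -> K) (r : A).

(** The quantifier over [f] comes after [x] because the proof of
    [right_ideal_preserving_value] uses the same [x] with [f] and with [f \o a].
    If [M_- <> M], any [x] of [M] outside [M_-] will do; if [M_- = M], any
    nonzero [x] of [M]. *)
Lemma exists_vector_combination M : nest_set N M -> M <> [set 0] ->
  exists x, [/\ M x, x != 0 & forall f r, bounded_functional f ->
    annihilates f (nest_pred N M) -> (forall y, r y = f y *: x) ->
    idempotent_combination r].
Proof.
move=> NM M0; have [MM|MM] := pselect (nest_pred N M = M).
  have [P [bP MP PM]] :=
    complemented_projection (nest_closed_subspace NM) (compl NM MM).
  have [x [Mx x0]] : exists x, M x /\ x != 0.
    apply: contrapT => /forallNP H; apply: M0; apply/seteqP; split=> [x Mx|_ ->].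
      by apply: contrapT => /eqP x0; apply: (H x).
    by have /is_subspaceP[] := (nest_closed_subspace NM).1.
  exists x; split => // f r bf fM rE; rewrite MM in fM.
  exact: rank_one_combination_projection NM Mx fM bP MP PM rE.
have [x Mx Px] := nest_pred_gap NM MM.
have sP := nest_closed_subspace (nest_pred_mem N M).
have [g [bg gP gx]] := separation sP Px.
exists x; split => //.
  by apply: contra_not_neq Px => ->; have /is_subspaceP[] := sP.1.
move=> f r bf fM rE.
by apply: (rank_one_combination_vector NM Mx bf bg fM gP _ rE); rewrite gx oner_eq0.
Qed.

(** The dual of [exists_vector_combination]: [f] is fixed first and used with
    both [x] and [a x]. *)
Lemma exists_functional_combination M : nest_set N M -> nest_pred N M <> setT ->
  exists f, [/\ bounded_functional f, annihilates f (nest_pred N M),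
    exists y, f y != 0 & forall x r, M x -> (forall y, r y = f y *: x) ->
    idempotent_combination r].
Proof.
move=> NM MT; have sP := nest_closed_subspace (nest_pred_mem N M).
have [MM|MM] := pselect (nest_pred N M = M).
  have [P [bP MP PM]] :=
    complemented_projection (nest_closed_subspace NM) (compl NM MM).
  have [y Py] : exists y, ~ nest_pred N M y.
    by apply/existsNP => H; apply: MT; apply/seteqP; split => // y _; exact: H.
  have [f [bf fP fy]] := separation sP Py.
  exists f; split => //; first by exists y; rewrite fy oner_eq0.
  move=> x r Mx rE; rewrite MM in fP.
  exact: rank_one_combination_projection NM Mx fP bP MP PM rE.
have [y My Py] := nest_pred_gap NM MM.
have [f [bf fP fy]] := separation sP Py.
have fy0 : f y != 0 by rewrite fy oner_eq0.
exists f; split => //; first by exists y.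
by move=> x r Mx; apply: (rank_one_combination_functional NM Mx My bf fP fy0).
Qed.

(** If [z], a value of [psi a - a * psi 1], were nonzero, there would be a nonzero
    [M] in the nest with [z] outside [M_-] and a rank-one [r], with [f z = 1], that
    does not kill [z]; but [r] kills [psi a - a * psi 1]. *)
Lemma right_ideal_preserving_value (psi : {linear A -> A}) a :
  right_ideal_preserving psi -> psi a = a * psi 1.
Proof.
move=> pres; apply/nest_op_eq => u; apply/eqP; rewrite -subr_eq0.
set z := _ - _; apply: contraT => /nest_pred_separates - /(_ N)[M [NM M0 Pz]].
have [x [Mx x0 comb]] := exists_vector_combination NM M0.
have [f [bf fP fz]] := separation (nest_closed_subspace (nest_pred_mem N M)) Pz.
have [r rE] := rank_one_exists NM Mx bf fP.
have bfa : bounded_functional (f \o a).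
  have [[lf [C C0 fC]] [la [D D0 aD]]] := (bf, nest_op_linear a); split.
    by move=> c v w /=; rewrite la lf.
  exists (C * D) => [|v]; first exact: mulr_ge0.
  by rewrite (le_trans (fC _))// -mulrA ler_wpM2l.
have fPa : annihilates (f \o a) (nest_pred N M).
  by move=> v Pv; apply: fP; apply: nest_op_invariant Pv; exact: nest_pred_mem.
have raE y : (r * a) y = (f \o a) y *: x by exact: rE.
have : r * psi a = r * (a * psi 1).
  rewrite -(idempotent_combination_right pres (comb _ _ bf fP rE)) mulrA.
  by rewrite -(idempotent_combination_right pres (comb _ _ bfa fPa raE)) mulr1.
move=> /(congr1 (fun s : A => s u)) rpsi.
have : r (psi a u) = r ((a * psi 1) u) by exact: rpsi.
rewrite !rE => /eqP; rewrite -subr_eq0 -scalerBl scaler_eq0 (negPf x0) orbF.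
have fB v w : f (v - w) = f v - f w.
  by rewrite addrC -scaleN1r bf.1 mulN1r addrC.
by rewrite -fB -/z fz oner_eq0.
Qed.

(** The kernel of [psi a - psi 1 * a] is closed and contains the range of every
    rank-one [r] for which [r] and [a * r] are combinations of idempotents. *)
Lemma left_ideal_preserving_value (psi : {linear A -> A}) a :
  left_ideal_preserving psi -> psi a = psi 1 * a.
Proof.
move=> pres; apply/nest_op_eq => u.
pose T := psi a - psi 1 * a.
have TE v : T v = psi a v - (psi 1 * a) v by [].
suff : [set v | T v = 0] = setT.
  move=> TT; have Tu : [set v | T v = 0] u by rewrite TT.
  by apply/eqP; rewrite -subr_eq0 -TE; apply/eqP; exact: Tu.
apply: (nest_join_full (N := N)).
  exact: kernel_closed_subspace (nest_op_linear T).
move=> M NM MT x Mx /=.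
have [f [bf fP [y fy] comb]] := exists_functional_combination NM MT.
have [r rE] := rank_one_exists NM Mx bf fP.
have arE v : (a * r) v = f v *: a x.
  by rewrite -nest_opZ -rE.
have : psi a * r = psi 1 * (a * r).
  rewrite -(idempotent_combination_left pres (comb _ _ Mx rE)).
  rewrite -(idempotent_combination_left pres (comb _ _ _ arE)) ?mul1r//.
  exact: nest_op_invariant Mx.
move=> E; have : (psi a * r) y - (psi 1 * (a * r)) y = 0 by rewrite E subrr.
change (psi a (r y) - (psi 1 * a) (r y) = 0 -> T x = 0).
rewrite -TE rE nest_opZ => /eqP; rewrite scaler_eq0 (negPf fy) => /eqP.
exact.
Qed.
End Centralizers.

Theorem corollary3p5 (R : realType) (k : scalar_kind)
    (X : completeNormedModType (scalars R k)) (dimX : dim_ge X 2)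
    (N : nest X)
    (compl : forall M : set X, nest_set N M -> nest_pred N M = M -> complemented M)
    (psi : {linear nest_alg N -> nest_alg N}) :
  (right_ideal_preserving psi <-> right_centralizer psi) /\
  (left_ideal_preserving psi <-> left_centralizer psi).
Proof.
split; split=> [pres|cent].
- move=> a b; have value := right_ideal_preserving_value compl _ pres.
  by rewrite (value (a * b)) (value b) mulrA.
- move=> J [_ JM] _ [j Jj <-].
  by rewrite -[j]mulr1 cent; exact: JM.
- move=> a b; have value := left_ideal_preserving_value compl _ pres.
  by rewrite (value (a * b)) (value a) mulrA.
- move=> J [_ JM] _ [j Jj <-].
  by rewrite -[j]mul1r cent; exact: JM.
Qed.
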